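(* Let $\mu,l,m\geq 1$, $s\geq 0$ and $1\leq\rho\leq\mu$ be integers with $\gcd(m,\mu+1)=1$. Let $$\lambda=\Lambda(\mu,s,l,\rho,m)=\left((m(s+l+1))^{\rho},(m(s+l))^{\mu},(m(s+l-1))^{\mu},\ldots,(m(s+1))^{\mu}\right)$$ and $N=(s+l+1)\mu+s+\rho$. Then $\zeta_{\lambda}^{x}$ (the $x$-monic nonsymmetric Jack polynomial in $N$ variables) is a singular polynomial for $S_N$ with singular value $-\frac{m}{\mu+1}$; that is, the coefficients of $\zeta_\lambda^x$ have no pole at $\kappa=-\frac{m}{\mu+1}$, and the polynomial obtained by setting $\kappa=-\frac{m}{\mu+1}$ is annihilated by every $\mathcal{D}_i$, $1\leq i\leq N$, specialized to $\kappa=-\frac{m}{\mu+1}$.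
   Context: $\kappa$ is a formal parameter (transcendental over $\mathbb{Q}$); polynomials in $x=(x_1,\ldots,x_N)$ have coefficients in $\mathbb{Q}(\kappa)$. For $w\in S_N$, $(xw)_i=x_{w(i)}$ and $wf(x)=f(xw)$; $(i,j)$ denotes the transposition interchanging $x_i$ and $x_j$. Dunkl operators: $\mathcal{D}_i f(x)=\frac{\partial}{\partial x_i}f(x)+\kappa\sum_{j\neq i}\frac{f(x)-(i,j)f(x)}{x_i-x_j}$. Set $\mathcal{U}_i f=\mathcal{D}_i(x_i f)-\kappa\sum_{j=1}^{i-1}(j,i)f$, $1\leq i\leq N$. A number $\kappa_0$ is a singular value if there is a nonzero polynomial $p$ with $\mathcal{D}_ip=0$ for all $1\leq i\leq N$ when $\kappa$ is specialized to $\kappa_0$; such $p$ is called a singular polynomial. For $\alpha\in\mathbb{N}_0^N$ ($\mathbb{N}_0=\{0,1,2,\ldots\}$), $|\alpha|=\sum\alpha_i$, $\alpha^+$ is the nonincreasing rearrangement of $\alpha$. $\alpha\succ\beta$ means $\alpha\neq\beta$ and $\sum_{i=1}^j\alpha_i\geq\sum_{i=1}^j\beta_i$ for $1\leq j\leq N$; $\alpha\vartriangleright\beta$ means $|\alpha|=|\beta|$ and either $\alpha^+\succ\beta^+$, or $\alpha^+=\beta^+$ and $\alpha\succ\beta$. The rank function is $r(\alpha,i)=\#\{j:\alpha_j>\alpha_i\}+\#\{j:1\leq j\leq i,\alpha_j=\alpha_i\}$ and $\xi_i(\alpha)=(N-r(\alpha,i))\kappa+\alpha_i+1$. The $x$-monic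 nonsymmetric Jack polynomial $\zeta_\alpha^x$ is the unique polynomial $\zeta_\alpha^x=x^\alpha+\sum_{\alpha\vartriangleright\beta}A^x_{\beta\alpha}x^\beta$, $A^x_{\beta\alpha}\in\mathbb{Q}(\kappa)$, with $\mathcal{U}_i\zeta^x_\alpha=\xi_i(\alpha)\zeta^x_\alpha$ for $1\leq i\leq N$. Exponents in partitions denote multiplicities, and partitions of length at most $N$ are viewed as elements of $\mathbb{N}_0^N$ by appending zeros. *)

(* Defs.v *)
(* Indices are 0-based: x_1, ..., x_N are 'X_i for i : 'I_N. Elements of N_0^N
   are multinomials 'X_{1..N}. *)
From mathcomp Require Export all_boot all_order all_fingroup all_algebra.
From mathcomp Require Export mpoly.

Set Implicit Arguments.
Unset Strict Implicit.
Unset Printing Implicit Defensive.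

Import GRing.Theory.

Local Open Scope ring_scope.

(* Q(kappa). *)
Definition Qkappa : fieldType := {fraction {poly rat}}.
Definition kappa : Qkappa := FracField.tofrac ('X : {poly rat}).

(* (i,j)f for the action (wf)(x) = f(xw), (xw)_i = x_(w i). *)
Definition swap (F : fieldType) (N : nat) (i j : 'I_N) (f : {mpoly F[N]}) :
  {mpoly F[N]} := msym (tperm i j) f.

Lemma divdiff_ex (F : fieldType) (N : nat) (i j : 'I_N) (f : {mpoly F[N]}) :
  exists q : {mpoly F[N]}, ('X_i - 'X_j) * q == f - swap i j f.
Proof.
suff [q Hq]: exists q : {mpoly F[N]}, ('X_i - 'X_j) * q = f - swap i j f.
  by exists q; apply/eqP.
pose P (g : {mpoly F[N]}) :=
  exists q : {mpoly F[N]}, ('X_i - 'X_j) * q = g - swap i j g.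
have PM g h : P g -> P h -> P (g * h).
  move=> [a Ha] [b Hb]; exists (a * h + swap i j g * b).
  rewrite mulrDr mulrA Ha mulrCA Hb /swap msymM mulrBl mulrBr addrA.
  by rewrite addrNK.
have P1 : P 1 by exists 0; rewrite mulr0 /swap msym1 subrr.
have PX k : P 'X_k.
  have Ek : swap i j 'X_k = 'X_(tperm i j k) :> {mpoly F[N]}.
    rewrite /swap msymX; congr mpolyX; apply/mnmP=> t.
    by rewrite !mnmE tpermV -{1}(tpermK i j k) (inj_eq perm_inj).
  rewrite /P Ek.
  case: tpermP => [->|->|_ _].
  - by exists 1; rewrite mulr1.
  - by exists (-1); rewrite mulrN1 opprB.
  - by exists 0; rewrite mulr0 subrr.
have Pm b : P 'X_[b].
  rewrite mpolyXE_id; apply: big_ind => // k _.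
  by elim: (b k) => [|e IH]; rewrite ?expr0 // exprS; apply: PM.
elim/mpolyind: f => [|c b g _ _ [q Hq]].
  by exists 0; rewrite mulr0 /swap msym0 subrr.
have [r Hr] := Pm b; exists (c *: r + q).
rewrite mulrDr -scalerAr Hr Hq /swap msymD msymZ scalerBr.
by rewrite addrACA opprD.
Qed.

(* The polynomial (f - (i,j)f) / (x_i - x_j); for i != j the choice is unique,
   since {mpoly F[N]} is an integral domain. *)
Definition divdiff (F : fieldType) (N : nat) (i j : 'I_N) (f : {mpoly F[N]}) :
  {mpoly F[N]} := xchoose (divdiff_ex i j f).

Definition dunkl (F : fieldType) (N : nat) (k : F) (i : 'I_N)
    (f : {mpoly F[N]}) : {mpoly F[N]} :=
  f^`M(i) + k *: \sum_(j < N | j != i) divdiff i j f.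

Definition opU (F : fieldType) (N : nat) (k : F) (i : 'I_N)
    (f : {mpoly F[N]}) : {mpoly F[N]} :=
  dunkl k i ('X_i * f) - k *: \sum_(j < N | (j < i)%N) swap j i f.

Definition singular_poly (F : fieldType) (N : nat) (k : F)
    (p : {mpoly F[N]}) : Prop :=
  p != 0 /\ forall i : 'I_N, dunkl k i p = 0.

(* Meant for sequences of length N; j is the number of leading terms summed. *)
Definition dominates (N : nat) (a b : seq nat) : Prop :=
  a <> b /\
  forall j : nat, (1 <= j <= N)%N -> (sumn (take j b) <= sumn (take j a))%N.

Definition comp_plus (N : nat) (a : 'X_{1..N}) : seq nat := sort geq a.

Definition comp_gt (N : nat) (a b : 'X_{1..N}) : Prop :=
  mdeg a = mdeg b /\
  (dominates N (comp_plus a) (comp_plus b) \/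
   (comp_plus a = comp_plus b /\ dominates N a b)).

Definition rank (N : nat) (a : 'X_{1..N}) (i : 'I_N) : nat :=
  (#|[set j : 'I_N | (a i < a j)%N]|
   + #|[set j : 'I_N | (j <= i)%N && (a j == a i)]|)%N.

Definition xi (N : nat) (a : 'X_{1..N}) (i : 'I_N) : Qkappa :=
  (N%:R - (rank a i)%:R) * kappa + (a i)%:R + 1.

Definition is_jack (N : nat) (a : 'X_{1..N}) (z : {mpoly Qkappa[N]}) : Prop :=
  [/\ z@_a = 1,
      forall b : 'X_{1..N}, b != a -> z@_b != 0 -> comp_gt a b &
      forall i : 'I_N, opU kappa i z = xi a i *: z].

(* The rational function c has no pole at k0, and its value there is v. *)
Definition value_at (k0 : rat) (c : Qkappa) (v : rat) : Prop :=
  exists p q : {poly rat},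
    [/\ q.[k0] != 0, c = FracField.tofrac p / FracField.tofrac q
      & v = p.[k0] / q.[k0]].

(* No coefficient of f has a pole at k0, and g is f at kappa = k0. *)
Definition specializes (N : nat) (k0 : rat) (f : {mpoly Qkappa[N]})
    (g : {mpoly rat[N]}) : Prop :=
  forall b : 'X_{1..N}, value_at k0 f@_b g@_b.

Definition Lambda (mu s l rho m : nat) : seq nat :=
  nseq rho (m * (s + l + 1))%N
  ++ flatten [seq nseq mu (m * (s + l - t))%N | t <- iota 0 l].

Definition pad (N : nat) (a : seq nat) : 'X_{1..N} :=
  [multinom nth 0%N a i | i < N].

Lemma value_at_uniq (k0 : rat) (c : Qkappa) (v w : rat) :
  value_at k0 c v -> value_at k0 c w -> v = w.
Proof.
move=> [p [q [Hq Hc ->]]] [p' [q' [Hq' Hc' ->]]].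
have nz r : r.[k0] != 0 -> FracField.tofrac r != 0 :> {fraction {poly rat}}.
  by rewrite tofrac_eq0; apply: contraNneq => ->; rewrite horner0.
apply/eqP; rewrite eqr_div //.
move/eqP: (etrans (esym Hc) Hc'); rewrite eqr_div ?nz // -!tofracM.
by rewrite tofrac_eq => /eqP /(congr1 (horner^~ k0)); rewrite !hornerM => ->.
Qed.

(* Main.v *)
(* At kappa = k0 = -m/n with n = mu + 1, let the positions 1, ..., N carry the
   contents (xi_i(lambda) - 1) / k0. They are those of the row-reading standard
   tableau of shape ((s+1)n - 1, mu^l, rho), whose boxes are read from i = N
   down to i = 1. Two facts drive the proof.

   Rigidity: a composition gamma whose spectral vector at k0 is that of lambda,
   up to exchanging two positions in one row, or moving the first box of a row
   past the whole preceding row, has the same heights as lambda.  With lambda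
   itself this separates spectra, so zeta_lambda has no pole at k0: otherwise,
   clearing the pole and setting kappa = k0 would give an eigenvector with the
   spectrum of lambda whose x^lambda-coefficient is 0.

   Descent: let p be the specialization.  Since U_N = 1 + x_N D_N on polynomials,
   D_N p = 0.  If i and i+1 lie in one row, then (i,i+1)p = p and D_i p is the
   image of D_{i+1} p.  If i is the first box of a row and the preceding row has L
   boxes, the intertwiners (j,j+1) - c move the spectral value of i past that row
   and express D_i p by D_{i+L} v_L.  The last one has c = -1, so v_L is invariant
   under (i+L-1,i+L), whereas by rigidity its leading exponent is smaller than the
   exchanged one; hence v_L = 0. *)
Require Import Defs.
From mathcomp Require Import generic_quotient zify ring lra.

Import Order.TTheory GRing.Theory Num.Theory.

Set Implicit Arguments.
Unset Strict Implicit.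
Unset Printing Implicit Defensive.

Local Open Scope ring_scope.

(** * Uniqueness of the path through a tableau *)

(* Boxes are numbered k = 0, 1, ... row by row, from the last position down; box
   k has height G k in lambda / m and content k - n * G k.  A composition with
   the same contents has height G k + q k on box k and reversed rank
   T k = k + n * q k; [bef] is the order of the boxes that breaks ties. *)
Section Rows.
Local Open Scope int_scope.
Variables (N n : nat) (G T : nat -> nat) (q : nat -> int).
Variable bef : nat -> nat -> Prop.
Hypothesis n_gt1 : (1 < n)%N.
Hypothesis T_inj : forall j k, (j < N)%N -> (k < N)%N -> T j = T k -> j = k.
Hypothesis T_surj : forall t, (t < N)%N -> exists2 k, (k < N)%N & T k = t.
Hypothesis T_lt : forall k, (k < N)%N -> (T k < N)%N.
Hypothesis T_mod : forall k, (k < N)%N -> (T k)%:Z = k%:Z + n%:Z * q k.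
Hypothesis q_ge : forall k, (k < N)%N -> 0 <= (G k)%:Z + q k.
Hypothesis T_ord : forall j k, (j < N)%N -> (k < N)%N -> (T j < T k)%N ->
  (G j)%:Z + q j < (G k)%:Z + q k \/
  ((G j)%:Z + q j = (G k)%:Z + q k /\ bef j k).

Hypothesis bef_uniq : forall j k j' k',
  (k < j)%N -> (k' < j')%N -> bef j k -> bef j' k' -> j = j'.

(** [T] is the content plus [n] times the height [G k + q k]. Between consecutive values of [T] the
    content thus changes by [1 - n * d], with [d] the height difference, nonnegative by [T_ord]. *)
Lemma pred_content j k : (j < N)%N -> (k < N)%N -> (T j).+1 = T k ->
  exists d : nat,
    [/\ (j + n * G k + 1 = k + n * G j + n * d)%N & d = 0%N -> bef j k].
Proof.
move=> jN kN jk.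
have lt : (T j < T k)%N by lia.
have := T_mod jN; have := T_mod kN.
case: (T_ord jN kN lt) => [H|[H b]] Ek Ej.
  exists (absz ((G k)%:Z + q k - ((G j)%:Z + q j))%R); split; last by lia.
  have E : Posz ((absz ((G k)%:Z + q k - ((G j)%:Z + q j))%R))
      = (G k)%:Z + q k - ((G j)%:Z + q j) by lia.
  move: E; move: (absz _) => d E.
  have /(congr1 (fun z => n%:Z * z)) := E; nia.
exists 0%N; split=> //.
have /(congr1 (fun z => n%:Z * z)) := H; nia.
Qed.

(* Along increasing T, contents go up by 1, or drop by n * d - 1 with d > 0.  In a
   row, contents n - 1 above that of a box occur only in the row itself, which
   forces each box to follow its left neighbour; then nothing can precede the
   first box except the previous row. *)
Lemma row_fixed K L g :
  (0 < L)%N -> (K + L <= N)%N ->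
  (forall j, (j < K)%N -> T j = j) ->
  (if K is 0 then g = 0%N else L < n)%N ->
  (forall k, (K <= k < K + L)%N -> G k = g) ->
  (forall j, (K + L <= j < N)%N -> (j + n * g + 3 <= K + n * G j + n)%N) ->
  (forall j k, (j < N)%N -> (K <= k < K + L)%N -> (k < j)%N -> bef j k ->
     (j + n * G k + 1 = k + n * G j)%N -> k = K /\ j = (K + L)%N) ->
  forall k, (k < K + L)%N -> T k = k.
Proof.
move=> L0 KL fixK K0 GK Glt befK.
have geK k : (K <= k < N)%N -> (K <= T k)%N.
  move=> kK; rewrite leqNgt; apply/negP=> lt.
  have := fixK _ lt => /T_inj; lia.
(* Downward induction along the row: once the boxes from [u] on are consecutive, the predecessor of
   [K + u] is sought in earlier rows, in the row itself and in later rows. *)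
have step u : (0 < u < L)%N ->
    (forall v, (u <= v < L)%N -> T (K + v) = T (K + u) + (v - u))%N ->
    T (K + u)%N = (T (K + u.-1)).+1.
  move=> uL run.
  have Tk0 : (0 < T (K + u))%N.
    case: (posnP K) => [K_0|Kp]; last by have := geK (K + u)%N; lia.
    rewrite K_0 in K0 *; rewrite add0n; have gu : G u = 0%N by rewrite GK; lia.
    have := q_ge (k := u) ltac:(lia); rewrite gu add0r => qu.
    have := T_mod (k := u) ltac:(lia); nia.
  have [|j jN jE] := T_surj (t := (T (K + u)).-1).
    by have := T_lt (k := (K + u)%N); lia.
  have [|d [E bj]] := pred_content (k := (K + u)%N) jN _ ltac:(lia); first by lia.
  (* An earlier row would force [T (K + u) = K], so that [n] divides [u], while [0 < u < n]. *)
  have [jK|Kj] := ltnP j K.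
    have Tj := fixK _ jK.
    have TK : T (K + u)%N = K by have := geK (K + u)%N; lia.
    have := T_mod (k := (K + u)%N) ltac:(lia).
    have uLn : (u < n)%N by case: K K0 jK {fixK KL GK Glt befK geK run Tk0 jE E bj Tj TK} => // K' Ln _; lia.
    rewrite TK; move: (q _) => r rE; have {}rE : Posz u + Posz n * r = 0 by lia.
    have [r0|r0] : (0 <= r \/ r <= -1) by lia.
      by nia.
    by nia.
  have [jL|Lj] := ltnP j (K + L).
    rewrite !GK in E; [|lia|lia].
    have [ju|ju] := ltnP j (K + u); last first.
      have := run (j - K)%N ltac:(lia); have -> : (K + (j - K) = j)%N by lia.
      by lia.
    have d0 : d = 0%N by case: (posnP d) => // /(leq_pmulr n); lia.
    have -> : (K + u.-1 = j)%N by nia.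
    by lia.
  (* In a later row [Glt] leaves only [d = 0], and [befK] then makes [K + u] the first box of the
     row, against [0 < u]. *)
  have Fj := Glt j ltac:(lia).
  rewrite (GK (K + u)%N) in E; last by lia.
  have d0 : d = 0%N by case: (posnP d) => // /(leq_pmulr n); lia.
  subst d; have [|||] := befK _ (K + u)%N jN _ _ (bj erefl).
  - by lia.
  - by lia.
  - by rewrite (GK (K + u)%N); lia.
  by lia.
have run d u v : (L - u <= d)%N -> (u <= v < L)%N ->
    T (K + v)%N = (T (K + u) + (v - u))%N.
  elim: d u v => [|d IH] u v du uv; first by lia.
  have [->|uv'] := eqVneq u v; first by lia.
  have IHu := IH u.+1 v ltac:(lia) ltac:(lia).
  have -> : (v - u = (v - u.+1).+1)%N by lia.
  rewrite IHu (step u.+1) /=; [by lia|by lia|].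
  by move=> w w_lt; apply: IH; lia.
have TK : T K = K.
  have := geK K ltac:(lia); rewrite leq_eqVlt => /orP[/eqP//|ltK].
  (* If [K < T K], the predecessor [k1] of the first box is [K + L]. If [T k1 = K], then [n] divides
     1; otherwise the predecessor [k2] of [k1] is a second box moved ahead of a smaller one, against
     [bef_uniq]. *)
  have [|k1 k1N k1E] := T_surj (t := (T K).-1).
    by have := T_lt (k := K); lia.
  have notrow k : (T k <= T K)%N -> (K < k < K + L)%N -> False.
    move=> le kL; have := run L 0%N (k - K)%N ltac:(lia) ltac:(lia).
    by rewrite addn0 subnKC; lia.
  have out k : (k < N)%N -> (K <= T k)%N -> (T k < T K)%N -> (K + L <= k)%N.
    move=> kN KTk lt; have [kK|] := ltnP k K; first by have := fixK _ kK; lia.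
    move=> Kk; rewrite leqNgt; apply/negP=> kL; apply: (notrow k); first by lia.
    by have [kK|] := eqVneq k K; [rewrite kK in lt; lia|lia].
  have k1L := out k1 k1N ltac:(lia) ltac:(lia).
  have [|d [E bk1]] := pred_content (k := K) k1N _ ltac:(lia); first by lia.
  have F := Glt k1 ltac:(lia).
  have gK := GK K ltac:(lia); rewrite gK in E.
  have d0 : d = 0%N by case: (posnP d) => // /(leq_pmulr n); lia.
  subst d.
  have [|||_ k1K] := befK _ K k1N _ _ (bk1 erefl); [lia|lia|by rewrite gK; lia|].
  have : (K <= T k1)%N by lia.
  rewrite leq_eqVlt => /orP[/eqP TK1|ltK1].
    have := T_mod k1N; rewrite -TK1; move: (q _) => r rE.
    pose w := r + Posz (G k1) - Posz g.
    have wE : Posz n * w = 1 by rewrite /w; lia.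
    have [w0|w0] : (w <= 0 \/ 1 <= w) by lia.
      by nia.
    by nia.
  have [|k2 k2N k2E] := T_surj (t := (T k1).-1).
    by have := T_lt k1N; lia.
  have k2L := out k2 k2N ltac:(lia) ltac:(lia).
  have [|d [E2 bk2]] := pred_content k2N k1N _; first by lia.
  have F2 := Glt k2 ltac:(lia).
  have d0 : d = 0%N by case: (posnP d) => // /(leq_pmulr n); lia.
  subst d.
  have k12 : k2 <> k1 by move=> k12; rewrite k12 in k2E; lia.
  by have := bef_uniq _ _ (bk1 erefl) (bk2 erefl); lia.
move=> k kL; have [kK|Kk] := ltnP k K; first exact: fixK.
have := run L 0%N (k - K)%N ltac:(lia) ltac:(lia).
by rewrite addn0 TK subnKC; lia.
Qed.
End Rows.

(** * Ranks and rigidity of spectra *)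

Section Rank.
Local Open Scope nat_scope.
Variables (N : nat) (a : 'X_{1..N}).

Lemma rankE i :
  rank a i = #|[set j : 'I_N | (a i < a j) || (a j == a i) && (j <= i)]|.
Proof.
rewrite /rank -cardsUI [X in _ + X](_ : _ = 0) ?addn0.
  by apply: eq_card => j; rewrite !inE andbC.
by apply: eq_card0 => j; rewrite !inE; case: ltngtP; rewrite ?andbF.
Qed.

Lemma rank_le_N i : rank a i <= N.
Proof. by rewrite rankE -[X in _ <= X]card_ord max_card. Qed.

Lemma rank_gt0 i : 0 < rank a i.
Proof. by rewrite rankE; apply/card_gt0P; exists i; rewrite inE eqxx leqnn orbT. Qed.

Lemma ltn_rank i j : rank a i < rank a j -> a j < a i \/ a j = a i /\ i < j.
Proof.
rewrite !rankE => lt.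
suff : ~~ ((a i < a j) || (a j == a i) && (j <= i)) by lia.
apply: contraL lt => le; rewrite -leqNgt; apply: subset_leq_card.
by apply/subsetP => k; rewrite !inE; lia.
Qed.

(** Of the two sets counted by [rankE] one contains the other, so equal cardinals make them equal,
    and each index lies in its own set. *)
Lemma rank_inj : injective (rank a).
Proof.
suff le i j : rank a i = rank a j -> a j <= a i /\ (a j = a i -> i <= j).
  by move=> i j Eij; apply: val_inj => /=; have := le _ _ Eij; have := le _ _ (esym Eij); lia.
rewrite !rankE => E.
suff /eqP/setP/(_ i) : [set k : 'I_N | (a i < a k) || (a k == a i) && (k <= i)]
   == [set k : 'I_N | (a j < a k) || (a k == a j) && (k <= j)] by rewrite !inE; lia.
have [le|le] : ((a i < a j) || (a j == a i) && (j <= i)) \/ ((a j < a i) || (a j == a i) && (i <= j)) by lia.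
  by rewrite eq_sym eqEcard E leqnn andbT; apply/subsetP => k; rewrite !inE; lia.
by rewrite eqEcard E leqnn andbT; apply/subsetP => k; rewrite !inE; lia.
Qed.

Lemma rank_nonincreasing :
  (forall i j : 'I_N, i <= j -> a j <= a i) -> forall i : 'I_N, rank a i = i.+1.
Proof.
move=> dec i; rewrite rankE -sum1_card -[RHS](card_ord i.+1) -sum1_card.
rewrite (big_ord_widen _ (fun=> 1) (ltn_ord i)); apply: eq_bigl => j.
by rewrite inE ltnS; have := dec i j; have := dec j i; case: (ltngtP j i); lia.
Qed.
End Rank.

(* The rows of the tableau: row 0 has the (s+1)(mu+1) - 1 zeros of Lambda, the
   later ones have mu boxes, and [height] is the value of Lambda divided by m. *)
Definition row_start (mu s r : nat) : nat :=
  if r is r'.+1 then ((s + 1) * mu + s + r' * mu)%N else 0%N.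

Definition height (mu s k : nat) : nat :=
  let Z := ((s + 1) * mu + s)%N in
  if (k < Z)%N then 0%N else (s + 1 + (k - Z) %/ mu)%N.

Lemma height_row mu s r k : (0 < mu)%N -> (row_start mu s r <= k < row_start mu s r.+1)%N ->
  height mu s k = if r is r'.+1 then (s + 1 + r')%N else 0%N.
Proof.
move=> mu0 /andP[lo hi]; rewrite /height.
case: r lo hi => [|r] /= lo hi; first by rewrite ifT; lia.
rewrite ltnNge ifF; last by apply/negbF; lia.
congr (_ + _)%N; apply/eqP; rewrite eqn_leq leq_divRL // -ltnS ltn_divLR //; lia.
Qed.

(** The content of the first box drops by one from each row to the next, also from row 0 to row 1,
    where it goes from 0 to -1. Later rows have [mu] boxes, so their contents exceed that of the
    first box of row [r] by at most [mu - 2]. *)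
Lemma height_above mu s r j : (0 < mu)%N -> (row_start mu s r.+1 <= j)%N ->
  (j + mu.+1 * (if r is r'.+1 then s + 1 + r' else 0) + 3
     <= row_start mu s r + mu.+1 * height mu s j + mu.+1)%N.
Proof.
move=> mu0 jr.
have Zj : ((s + 1) * mu + s <= j)%N by move: jr => /=; lia.
rewrite /height ltnNge Zj /=.
have E := divn_eq (j - ((s + 1) * mu + s)) mu.
have B := ltn_pmod (j - ((s + 1) * mu + s)) mu0.
set a := (_ %/ mu)%N in E *; set b := (_ %% mu)%N in E B.
have ra : (r <= a)%N by rewrite /a leq_divRL //; move: jr => /=; lia.
case: r jr ra => [|r] jr ra /=; first by nia.
have {}E : (j = (s + 1) * mu + s + a * mu + b)%N by lia.
move: ra E B; clear; move: a b => a b ra -> B; nia.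
Qed.

(** Clearing the denominator gives [n * (g' - m * g) = m * (t - k)]; by coprimality [n] divides
    [t - k], and [q] is the quotient. *)
Lemma spectrum_shift (m n t k g g' : nat) : (0 < n)%N -> coprime m n ->
  t%:R * - (m%:R / n%:R) + g'%:R = k%:R * - (m%:R / n%:R) + (m * g)%:R :> rat ->
  exists q : int, Posz t = Posz k + Posz n * q /\ Posz g' = Posz m * (Posz g + q).
Proof.
move=> n0 mn.
have n0' : n%:R != 0 :> rat by rewrite pnatr_eq0; lia.
set x := _ / _ => E0.
have xn : x * n%:R = m%:R by rewrite divfK.
have E : n%:R * g'%:R - t%:R * (x * n%:R) = n%:R * (m%:R * g%:R) - k%:R * (x * n%:R) :> rat.
  by move: E0 => /(congr1 (fun x => x * n%:R)); rewrite natrM; lra.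
rewrite xn {x E0 xn} in E.
have {}E : Posz n * Posz g' - Posz t * Posz m = Posz n * (Posz m * Posz g) - Posz k * Posz m.
  apply/eqP; rewrite -(@eqr_int rat) !rmorphB !rmorphM /=; apply/eqP.
  by rewrite -!pmulrn; lra.
have : (n %| (Posz t - Posz k) * m)%Z.
  by apply/dvdzP; exists (Posz g' - Posz m * Posz g); rewrite mulrBl; lia.
rewrite Gauss_dvdzl; last by rewrite coprimez_sym.
case/dvdzP => q Eq; exists q; split; first by lia.
have : Posz n * (Posz g' - Posz m * (Posz g + q)) = 0 by nia.
move/eqP; rewrite mulf_eq0 => /orP[/eqP|/eqP]; lia.
Qed.

(** [pos k] is the position of [a] with the content of box [k]. Boxes run from the last position
    down, so [k < j] with [pos k < pos j] is an inversion. All inversions must come from one moved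
    box, and contents may be consecutive only at the first boxes of adjacent rows. *)
Lemma spectrum_rigid (mu s m N : nat) (a : 'X_{1..N}) (pos : 'I_N -> 'I_N) :
  (0 < mu)%N -> (0 < m)%N -> coprime m mu.+1 -> injective pos ->
  (forall k : 'I_N, (N - rank a (pos k))%:R * - (m%:R / mu.+1%:R) + (a (pos k))%:R
     = k%:R * - (m%:R / mu.+1%:R) + (m * height mu s k)%:R :> rat) ->
  (forall j k j' k' : 'I_N, (k < j)%N -> (k' < j')%N ->
     (pos k < pos j)%N -> (pos k' < pos j')%N -> j = j') ->
  (forall j k : 'I_N, (k < j)%N -> (pos k < pos j)%N ->
     (j + mu.+1 * height mu s k + 1 = k + mu.+1 * height mu s j)%N ->
     exists r, k = row_start mu s r :> nat /\ j = row_start mu s r.+1 :> nat) ->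
  forall k : 'I_N, rank a (pos k) = (N - k)%N /\ a (pos k) = (m * height mu s k)%N.
Proof.
move=> mu0 m0 mn pos_inj spec uniq excl.
pose extn (f : 'I_N -> nat) k := odflt 0%N (omap f (insub k)).
have extnE f (k : 'I_N) : extn f k = f k by rewrite /extn valK.
pose T := extn (fun k => N - rank a (pos k))%N.
pose q k := ((Posz (T k) - Posz k) %/ mu.+1)%Z.
pose bef (j k : nat) := exists j' k' : 'I_N, [/\ j = j', k = k' & (pos k' < pos j')%N].
have shift (k : 'I_N) : Posz (T k) = Posz k + Posz mu.+1 * q k /\
    Posz (a (pos k)) = Posz m * (Posz (height mu s k) + q k).
  have [//|q' [E1 E2]] := spectrum_shift _ mn (spec k).
  have -> : q k = q' by rewrite /q /T extnE E1 addrC addKr mulKz.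
  by rewrite /T extnE.
have TE (k : 'I_N) : T k = (N - rank a (pos k))%N by rewrite /T extnE.
have Tlt k : (k < N)%N -> (T k < N)%N.
  move=> kN; rewrite -[k]/(val (Ordinal kN)) TE.
  by have := rank_gt0 a (pos (Ordinal kN)); have := rank_le_N a (pos (Ordinal kN)); lia.
have Tinj j k : (j < N)%N -> (k < N)%N -> T j = T k -> j = k.
  move=> jN kN; rewrite -[j]/(val (Ordinal jN)) -[k]/(val (Ordinal kN)) !TE.
  move=> E; congr val; apply/pos_inj/(@rank_inj _ a).
  have := rank_le_N a (pos (Ordinal kN)); have := rank_le_N a (pos (Ordinal jN)).
  by lia.
have Tsurj t : (t < N)%N -> exists2 k, (k < N)%N & T k = t.
  move=> tN; pose f (k : 'I_N) := Ordinal (Tlt k (ltn_ord k)).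
  have f_inj : injective f.
    by move=> j k [] /Tinj E; apply: val_inj; apply: E; exact: ltn_ord.
  exists (invF f_inj (Ordinal tN)); first exact: ltn_ord.
  by have /(congr1 val) := f_invF f_inj (Ordinal tN).
have Tmod k : (k < N)%N -> Posz (T k) = Posz k + Posz mu.+1 * q k.
  by move=> kN; have [] := shift (Ordinal kN).
have qge k : (k < N)%N -> 0 <= Posz (height mu s k) + q k.
  move=> kN; have [_] := shift (Ordinal kN) => /= E.
  by rewrite -(@pmulr_rge0 _ (Posz m)) // -E.
have Tord j k : (j < N)%N -> (k < N)%N -> (T j < T k)%N ->
    Posz (height mu s j) + q j < Posz (height mu s k) + q k \/
    (Posz (height mu s j) + q j = Posz (height mu s k) + q k /\ bef j k).
  move=> jN kN; rewrite -[j]/(val (Ordinal jN)) -[k]/(val (Ordinal kN)).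
  move: (Ordinal jN) (Ordinal kN) => {jN kN} {}j {}k; rewrite !TE => lt.
  have [|lta|[eqa ltp]] := @ltn_rank _ a (pos k) (pos j); first by lia.
    by left; rewrite -(@ltr_pM2l _ (Posz m)) // -!(shift _).2 ltz_nat.
  right; split; last by exists j, k.
  by apply: (@mulfI _ (Posz m)); [lia | rewrite -!(shift _).2 eqa].
have befu j k j' k' : (k < j)%N -> (k' < j')%N -> bef j k -> bef j' k' -> j = j'.
  move=> kj kj' [x [y [jx ky xy]]] [x' [y' [jx' ky' xy']]].
  by rewrite jx jx'; congr val; apply: (uniq x y x' y') => //; rewrite -?jx -?ky -?jx' -?ky'.
(* Induction over the rows with [row_fixed]; [minn N] truncates the last row, which may be
   incomplete. *)
have fixT : forall r k, (k < minn N (row_start mu s r))%N -> T k = k.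
  elim=> [|r IH] k kr; first by move: kr; rewrite minn0.
  have [Nr|rN] := leqP N (row_start mu s r).
    by apply: IH; move: kr; rewrite !leq_min => /andP[kN _]; lia.
  have rr : (row_start mu s r < row_start mu s r.+1)%N.
    by case: (r) => [|r'] /=; nia.
  have hrow x : (row_start mu s r <= x < row_start mu s r + (minn N (row_start mu s r.+1) - row_start mu s r))%N ->
      height mu s x = if r is r'.+1 then (s + 1 + r')%N else 0%N.
    by move=> xr; apply: height_row => //; lia.
  apply: (row_fixed (q := q) (bef := bef) (N := N) (n := mu.+1) (G := height mu s)
    _ Tinj Tsurj Tlt Tmod qge Tord befu (K := row_start mu s r)
    (L := minn N (row_start mu s r.+1) - row_start mu s r) _ _ _ _ hrow) => //.
  - by lia.
  - by lia.
  - by move=> j jr; apply: IH; lia.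
  - case: (r) => [//|r'] /=.
    by case E: ((s + 1) * mu + s + r' * mu)%N => [|x]; [nia | rewrite -E; lia].
  - by move=> j /andP[jr jN]; apply: height_above => //; lia.
  - move=> j k' jN kr' kj [x [y [jx ky xy]]] E; subst j k'.
    have [|||r' [yr xr]] := excl x y; [by lia|by []|by lia|].
    suff rr' : r' = r by subst r'; lia.
    have mono x1 x2 : (x1 < x2)%N -> (row_start mu s x1.+1 <= row_start mu s x2)%N.
      case: x2 => // x2; rewrite ltnS => x12 /=.
      by rewrite leq_add2l leq_mul2r x12 orbT.
    have [lt|gt|//] := ltngtP r' r.
      by have := mono _ _ lt; lia.
    by have := mono _ _ gt; lia.
  - by lia.
move=> k.
have Tk : T k = k.
  apply: (fixT k.+2); rewrite leq_min ltn_ord /=; nia.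
split; first by have := TE k; have := rank_le_N a (pos k); have := ltn_ord k; lia.
have [E1 E2] := shift k.
have q0 : q k = 0.
  have : Posz mu.+1 * q k = 0 by lia.
  by move/eqP; rewrite mulf_eq0 => /orP[/eqP|/eqP] //; lia.
by move: E2; rewrite q0 addr0; lia.
Qed.

(** * Dunkl operators and transpositions *)

Section Operators.
Variables (F : fieldType) (N : nat).
Implicit Types (f g : {mpoly F[N]}) (i j a b : 'I_N) (w : 'S_N) (k c : F).

Lemma XsubX_neq0 i j : i != j -> 'X_i - 'X_j != 0 :> {mpoly F[N]}.
Proof.
move=> ij; apply/eqP => /(congr1 (mcoeff U_(i))).
rewrite mcoeffB !mcoeffXU eqxx eq_sym (negbTE ij) mcoeff0 subr0.
by move/eqP; rewrite oner_eq0.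
Qed.

Lemma divdiffP i j f : ('X_i - 'X_j) * divdiff i j f = f - swap i j f.
Proof. exact/eqP/(xchooseP (divdiff_ex i j f)). Qed.

Lemma divdiff_uniq i j f q : i != j ->
  ('X_i - 'X_j) * q = f - swap i j f -> divdiff i j f = q.
Proof. by move=> ij E; apply: (mulfI (XsubX_neq0 ij)); rewrite divdiffP. Qed.

Lemma divdiffD i j f g : i != j ->
  divdiff i j (f + g) = divdiff i j f + divdiff i j g.
Proof.
move=> ij; apply: divdiff_uniq => //.
by rewrite mulrDr !divdiffP /swap msymD opprD addrACA.
Qed.

Lemma divdiffZ i j c f : i != j -> divdiff i j (c *: f) = c *: divdiff i j f.
Proof.
move=> ij; apply: divdiff_uniq => //.
by rewrite -scalerAr divdiffP /swap msymZ scalerBr.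
Qed.

Lemma dunklD k i f g : dunkl k i (f + g) = dunkl k i f + dunkl k i g.
Proof.
rewrite /dunkl mderivD (eq_bigr (fun j => divdiff i j f + divdiff i j g)).
  by rewrite big_split scalerDr addrACA.
by move=> j ji; rewrite divdiffD // eq_sym.
Qed.

Lemma dunklZ k i c f : dunkl k i (c *: f) = c *: dunkl k i f.
Proof.
rewrite /dunkl mderivZ (eq_bigr (fun j => c *: divdiff i j f)).
  by rewrite -scaler_sumr scalerDr !scalerA (mulrC c).
by move=> j ji; rewrite divdiffZ // eq_sym.
Qed.

Lemma opUD k i f g : opU k i (f + g) = opU k i f + opU k i g.
Proof.
rewrite /opU mulrDr dunklD (eq_bigr (fun j => swap j i f + swap j i g)).
  by rewrite big_split scalerDr opprD addrACA.
by move=> j _; rewrite /swap msymD.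
Qed.

Lemma opUZ k i c f : opU k i (c *: f) = c *: opU k i f.
Proof.
rewrite /opU -scalerAr dunklZ (eq_bigr (fun j => c *: swap j i f)).
  by rewrite -scaler_sumr scalerBr !scalerA (mulrC c).
by move=> j _; rewrite /swap msymZ.
Qed.

Lemma dunkl0 k i : dunkl k i (0 : {mpoly F[N]}) = 0.
Proof. by rewrite -[X in dunkl k i X](scale0r 0) dunklZ scale0r. Qed.

Lemma opU_sum k i (f : {mpoly F[N]}) :
  opU k i f = \sum_(m <- msupp f) f@_m *: opU k i 'X_[m].
Proof.
rewrite {1}[f]mpolyE; elim: (msupp f) => [|m r IH].
  by rewrite !big_nil -[X in opU k i X](scale0r 0) opUZ scale0r.
by rewrite !big_cons opUD opUZ IH.
Qed.

Lemma msymXU w i : msym w 'X_i = 'X_(w i) :> {mpoly F[N]}.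
Proof.
rewrite msymX; congr mpolyX; apply/mnmP=> t.
by rewrite !mnmE -{1}(permK w i) (inj_eq perm_inj).
Qed.

Lemma swapK i j : involutive (@swap F N i j).
Proof. by move=> f; rewrite /swap -msymMm tperm2 msym1m. Qed.

Lemma swapC i j f : swap i j f = swap j i f.
Proof. by rewrite /swap tpermC. Qed.

Lemma msym_swap w i j f : msym w (swap i j f) = swap (w i) (w j) (msym w f).
Proof. by rewrite /swap -!msymMm -tpermJ conjgC. Qed.

Lemma msym_divdiff w i j f : i != j ->
  msym w (divdiff i j f) = divdiff (w i) (w j) (msym w f).
Proof.
move=> ij; apply/esym/divdiff_uniq; first by rewrite (inj_eq perm_inj).
by rewrite -!msymXU -msymB -msymM divdiffP msymB msym_swap.
Qed.

Lemma msym_mderiv w i f : msym w f^`M(i) = (msym w f)^`M(w i).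
Proof.
apply/mpolyP => m; rewrite mcoeff_sym !mcoeff_mderiv mcoeff_sym mnmE.
congr (_@__ *+ _); apply/mnmP => t.
by rewrite !mnmE (inj_eq perm_inj).
Qed.

Lemma msym_sum w (I : Type) (r : seq I) (P : pred I) (G : I -> {mpoly F[N]}) :
  msym w (\sum_(x <- r | P x) G x) = \sum_(x <- r | P x) msym w (G x).
Proof. exact: raddf_sum. Qed.

Lemma msym_dunkl w k i f : msym w (dunkl k i f) = dunkl k (w i) (msym w f).
Proof.
rewrite /dunkl msymD msym_mderiv msymZ msym_sum; congr (_ + _ *: _).
rewrite [RHS](reindex_perm w) /=; apply: eq_big => j.
  by rewrite (inj_eq perm_inj).
by move=> ji; rewrite msym_divdiff // eq_sym.
Qed.

Lemma swapB a b f g : swap a b (f - g) = swap a b f - swap a b g.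
Proof. exact: msymB. Qed.

Lemma swapD a b f g : swap a b (f + g) = swap a b f + swap a b g.
Proof. exact: msymD. Qed.

Lemma swapZ a b c f : swap a b (c *: f) = c *: swap a b f.
Proof. exact: msymZ. Qed.

Lemma swap_dunkl a b k i f :
  swap a b (dunkl k i f) = dunkl k (tperm a b i) (swap a b f).
Proof. exact: msym_dunkl. Qed.

Lemma swap_XM a b i f : swap a b ('X_i * f) = 'X_(tperm a b i) * swap a b f.
Proof. by rewrite /swap msymM msymXU. Qed.

Lemma swap_sum_swap a b i (P : pred 'I_N) f :
  swap a b (\sum_(j | P j) swap j i f)
  = \sum_(j | P (tperm a b j)) swap j (tperm a b i) (swap a b f).
Proof.
rewrite {1}/swap msym_sum (reindex_perm (tperm a b)) /=.
by apply: eq_bigr => j _; rewrite msym_swap tpermK.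
Qed.

Lemma opU_swap_far k i a b f : i != a -> i != b -> b = a.+1 :> nat ->
  opU k i (swap a b f) = swap a b (opU k i f).
Proof.
move=> ia ib ab; rewrite /opU swapB swapZ swap_dunkl swap_XM swap_sum_swap.
rewrite tpermD ?(eq_sym _ i) //; congr (_ - _ *: _); apply: eq_bigl => j.
move: ia ib; rewrite -!val_eqE /=.
by case: tpermP => [->|->|//]; rewrite ?ab; lia.
Qed.

(** At [b] one more transposition is subtracted than at [a], namely that of [a] and [b]; composed
    with the outer exchange it leaves [k *: f]. *)
Lemma opU_swap_left k a b f : b = a.+1 :> nat ->
  opU k a (swap a b f) = swap a b (opU k b f) + k *: f.
Proof.
move=> ab; rewrite /opU swapB swapZ swap_dunkl swap_XM swap_sum_swap tpermR.
rewrite -[RHS]addrA; congr (_ + _).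
rewrite [in RHS](bigD1 b) /=; last by rewrite tpermR ab.
rewrite [swap b a _]swapC swapK scalerDr opprD [RHS]addrAC addNr add0r.
congr (- (_ *: _)); apply: eq_bigl => j; rewrite -!val_eqE /=.
by case: tpermP => [->|->|/eqP + /eqP +]; rewrite -?val_eqE /= ?ab; lia.
Qed.

Lemma opU_swap_right k a b f : b = a.+1 :> nat ->
  opU k b (swap a b f) = swap a b (opU k a f) - k *: f.
Proof.
move=> ab; have := @opU_swap_left k a b (swap a b f) ab.
by rewrite swapK => /(congr1 (swap a b)); rewrite swapD swapK swapZ swapK => ->; rewrite addrK.
Qed.

(** The value of [c] absorbs the terms [k *: f] of the two exchange rules. *)
Lemma opU_intertwine k a b c (e : 'I_N -> F) f : b = a.+1 :> nat ->
  (forall y, opU k y f = e y *: f) -> c * (e a - e b) = k ->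
  forall y, opU k y (swap a b f - c *: f)
    = e (tperm a b y) *: (swap a b f - c *: f).
Proof.
move=> ab ef ck y; rewrite -scaleNr opUD opUZ ef.
case: tpermP => [->|->|/eqP ya /eqP yb].
- rewrite opU_swap_left // ef swapZ.
  rewrite scalerDr -addrA; congr (_ + _); rewrite !scalerA -scalerDl.
  by congr (_ *: _); rewrite -ck; ring.
- rewrite opU_swap_right // ef swapZ.
  rewrite scalerDr -addrA -scaleNr; congr (_ + _); rewrite !scalerA -scalerDl.
  by congr (_ *: _); rewrite -ck; ring.
rewrite opU_swap_far // ef swapZ scalerDr !scalerA.
by rewrite mulrC.
Qed.
End Operators.

(** * The operators on monomials *)

Definition mset2 (N : nat) (m : 'X_{1..N}) (i j : 'I_N) (p q : nat) : 'X_{1..N} :=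
  [multinom if t == i then p else if t == j then q else m t | t < N].

(* (x_i^p x_j^q - x_i^q x_j^p) / (x_i - x_j) times the other variables of m; by
   truncated subtraction only one of the two sums is nonempty. *)
Definition divdiffX (R : comNzRingType) (N : nat) (m : 'X_{1..N}) (i j : 'I_N)
    (p q : nat) : {mpoly R[N]} :=
  \sum_(t < p - q) 'X_[mset2 m i j (p - t).-1 (q + t)]
  - \sum_(t < q - p) 'X_[mset2 m i j (p + t) (q - t).-1].

(** A form of [opU] on monomials that avoids the chosen quotient [divdiff] and makes sense over any
    commutative ring. The exponent [(m i).+1] is due to the factor [x_i] inside [opU]. *)
Definition opUX (R : comNzRingType) (N : nat) (k : R) (i : 'I_N) (m : 'X_{1..N}) :
    {mpoly R[N]} :=
  (m i).+1%:R *: 'X_[m]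
  + k *: \sum_(j < N | j != i)
      (divdiffX R m i j (m i).+1 (m j)
       - (if (j < i)%N then 'X_[mset2 m i j (m j) (m i)] else 0)).

Section Monomials.
Variable N : nat.
Implicit Types (m : 'X_{1..N}) (i j : 'I_N).

Lemma map_divdiffX (R S : comNzRingType) (f : {rmorphism R -> S}) m i j p q :
  map_mpoly f (divdiffX R m i j p q) = divdiffX S m i j p q.
Proof.
by rewrite /divdiffX rmorphB !rmorph_sum /=; congr (_ - _); apply: eq_bigr => t _; rewrite map_mpolyX.
Qed.

Lemma map_opUX (R S : comNzRingType) (f : {rmorphism R -> S}) k i m :
  map_mpoly f (opUX k i m) = opUX (f k) i m.
Proof.
rewrite /opUX rmorphD /= !map_mpolyZ map_mpolyX rmorph_nat rmorph_sum /=.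
congr (_ + _ *: _); apply: eq_bigr => j _; rewrite rmorphB /= map_divdiffX.
by case: ifP; rewrite ?map_mpolyX ?rmorph0.
Qed.

Lemma mset2_id m i j : mset2 m i j (m i) (m j) = m.
Proof. by apply/mnmP => t; rewrite mnmE; case: eqVneq => [->//|_]; case: eqVneq => [->|]. Qed.

Lemma mset2C m i j p q : i != j -> mset2 m i j p q = mset2 m j i q p.
Proof.
by move=> ij; apply/mnmP => t; rewrite !mnmE; case: (eqVneq t i) => // ->; rewrite (negbTE ij).
Qed.

Lemma mset2Si m i j p q : i != j -> (U_(i) + mset2 m i j p q)%MM = mset2 m i j p.+1 q.
Proof.
move=> ij; apply/mnmP => t; rewrite mnmDE mnm1E !mnmE.
by case: (eqVneq t i) => [_|_]; rewrite ?add1n ?add0n.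
Qed.

Lemma mset2Sj m i j p q : i != j -> (U_(j) + mset2 m i j p q)%MM = mset2 m i j p q.+1.
Proof. by move=> ij; rewrite mset2C // mset2Si 1?eq_sym // mset2C // eq_sym. Qed.

Section Field.
Variable F : fieldType.

Lemma swapX_mset2 m i j p q : i != j ->
  swap i j 'X_[mset2 m i j p q] = 'X_[mset2 m i j q p] :> {mpoly F[N]}.
Proof.
move=> ij; rewrite /swap msymX; congr mpolyX; apply/mnmP => t; rewrite !mnmE tpermV.
case: tpermP => [->|->|/eqP ti /eqP tj]; rewrite ?eqxx ?(negbTE ij) ?(eq_sym j) ?(negbTE ij) //.
by rewrite (negbTE ti) (negbTE tj).
Qed.

Lemma divdiff_mset2 m i j p q : i != j ->
  divdiff i j 'X_[mset2 m i j p q] = divdiffX F m i j p q.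
Proof.
move=> ij; apply: divdiff_uniq => //; rewrite swapX_mset2 //.
have Xi a b : 'X_i * 'X_[mset2 m i j a b] = 'X_[mset2 m i j a.+1 b] :> {mpoly F[N]}.
  by rewrite -mpolyXD mset2Si.
have Xj a b : 'X_j * 'X_[mset2 m i j a b] = 'X_[mset2 m i j a b.+1] :> {mpoly F[N]}.
  by rewrite -mpolyXD mset2Sj.
(* Multiplication by [x_i - x_j] makes the sum telescope. *)
have tel a b : (b <= a)%N -> ('X_i - 'X_j) * \sum_(t < a - b) 'X_[mset2 m i j (a - t).-1 (b + t)]
    = 'X_[mset2 m i j a b] - 'X_[mset2 m i j b a] :> {mpoly F[N]}.
  move=> ba; pose G t : {mpoly F[N]} := 'X_[mset2 m i j (a - t) (b + t)].
  transitivity (- \sum_(0 <= t < a - b) (G t.+1 - G t)).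
    rewrite big_mkord mulr_sumr -sumrN; apply: eq_bigr => t _.
    rewrite mulrBl Xi Xj opprB /G subnS addnS prednK //.
    by rewrite subn_gt0; have := ltn_ord t; lia.
  by rewrite telescope_sumr // opprB /G subn0 addn0 subKn // subnKC.
rewrite /divdiffX; have [qp|pq] := leqP q p.
  by rewrite (_ : (q - p = 0)%N) ?big_ord0 ?subr0 ?tel //; lia.
rewrite (_ : (p - q = 0)%N) ?big_ord0 ?sub0r; last by lia.
rewrite mulrN.
(* For [p < q], reversing the summation index gives the sum of [tel] with [p] and [q] exchanged. *)
transitivity (('X_i - 'X_j) * - \sum_(t < q - p) 'X_[mset2 m i j (q - t).-1 (p + t)] : {mpoly F[N]}).
  rewrite mulrN; congr (- (_ * _)).
  rewrite (reindex_inj rev_ord_inj) /=; apply: eq_bigr => t _; congr 'X_[mset2 _ _ _ _ _].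
    by have := ltn_ord t; lia.
  by have := ltn_ord t; lia.
by rewrite mulrN tel ?opprB // ltnW.
Qed.

Lemma opU_X (k : F) i m : opU k i 'X_[m] = opUX k i m.
Proof.
rewrite /opU /dunkl /opUX -mpolyXD mderivX mnmDE mnm1E eqxx add1n.
have -> : (U_(i) + m - U_(i))%MM = m by rewrite addmC addmK.
rewrite -addrA -scalerBr; congr (_ + _ *: _).
rewrite sumrB; congr (_ - _).
  apply: eq_bigr => j ji; rewrite -[in LHS](mset2_id m i j) mset2Si 1?eq_sym //.
  by rewrite divdiff_mset2 // eq_sym.
rewrite -big_mkcondr /=; apply: eq_big => j.
  by rewrite -val_eqE /=; lia.
move=> ji; have ij : j != i by rewrite -val_eqE /=; lia.
by rewrite -[in LHS](mset2_id m j i) swapX_mset2 // mset2C.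
Qed.
End Field.
End Monomials.

(* Replaces the order of the paper: replacing two parts by less spread ones
   decreases the dominant term N * sum m_i^2, and moving a larger part to the
   right keeps it and decreases sum (N - i) m_i. *)
Definition Phi (N : nat) (m : 'X_{1..N}) : nat :=
  (\sum_(i < N) m i * (N * m i + (N - i)))%N.

Definition low (R : comNzRingType) (N : nat) (m : 'X_{1..N}) (f : {mpoly R[N]}) :=
  forall b, (Phi m <= Phi b)%N -> f@_b = 0.

(** * Triangularity of the operators with respect to [Phi] *)

Section Triangular.
Variables (R : comNzRingType) (N : nat).
Implicit Types (m b : 'X_{1..N}) (i j : 'I_N) (f g : {mpoly R[N]}) (k : R).

Lemma Phi_mset2 m i j p q : i != j ->
  (Phi (mset2 m i j p q) + (m i * (N * m i + (N - i)) + m j * (N * m j + (N - j)))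
   = Phi m + (p * (N * p + (N - i)) + q * (N * q + (N - j))))%N.
Proof.
move=> ij; rewrite /Phi (bigD1 i) // (bigD1 j) 1?eq_sym //=.
rewrite [in RHS](bigD1 i) // [in RHS](bigD1 j) 1?eq_sym //=.
rewrite !mnmE !eqxx eq_sym (negbTE ij).
rewrite [X in (_ + (_ + X) + _)%N](eq_bigr (fun t : 'I_N => m t * (N * m t + (N - t)))%N).
  by lia.
by move=> t /andP[ti tj]; rewrite mnmE (negbTE ti) (negbTE tj).
Qed.

Lemma Phi_flat m i j p q : i != j -> (p + q = m i + m j)%N ->
  (maxn p q < maxn (m i) (m j))%N -> (Phi (mset2 m i j p q) < Phi m)%N.
Proof.
move=> ij pq lt; have := Phi_mset2 m p q ij; have := ltn_ord i; have := ltn_ord j.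
move: (Phi _) (Phi _) => P Q jN iN E.
suff : (p * (N * p + (N - i)) + q * (N * q + (N - j)) <
  m i * (N * m i + (N - i)) + m j * (N * m j + (N - j)))%N by lia.
move: (m i) (m j) pq lt iN jN {E} => a b pq lt iN jN.
(* Flattening lowers the quadratic part by [2 * N * t * u] and raises the linear part by at most
   [t * (J - I)], which is less than [N * t * u]. *)
have key I J c t u : (0 < I)%N -> (J <= N)%N -> (0 < t)%N -> (0 < u)%N ->
    ((c + u) * (N * (c + u) + I) + (c + t) * (N * (c + t) + J)
     < (c + t + u) * (N * (c + t + u) + I) + c * (N * c + J))%N.
  move=> I0 JN t0 u0.
  have tJ : (t * J <= N * t * u)%N by rewrite (mulnC N) -mulnA leq_mul2l; nia.
  have tI : (0 < t * I)%N by rewrite muln_gt0 t0.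
  by nia.
have [ba|ab] := leqP b a.
  have := @key (N - i)%N (N - j)%N b (q - b)%N (p - b)%N.
  have -> : (b + (p - b) = p)%N by lia.
  have -> : (b + (q - b) = q)%N by lia.
  have -> : (q + (p - b) = a)%N by lia.
  by apply; lia.
rewrite [X in (X < _)%N]addnC [X in (_ < X)%N]addnC.
have := @key (N - j)%N (N - i)%N a (p - a)%N (q - a)%N.
have -> : (a + (p - a) = p)%N by lia.
have -> : (a + (q - a) = q)%N by lia.
have -> : (p + (q - a) = b)%N by lia.
by apply; lia.
Qed.

Lemma Phi_swap m i j : (i < j)%N -> (m j < m i)%N ->
  (Phi (mset2 m i j (m j) (m i)) < Phi m)%N.
Proof.
move=> ij lt; have ij' : i != j by rewrite -val_eqE /=; lia.
have := Phi_mset2 m (m j) (m i) ij'; have := ltn_ord i; have := ltn_ord j.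
move: (Phi _) (Phi _) => P Q jN iN E.
have : (m i * (N - j) + m j * (N - i) < m i * (N - i) + m j * (N - j))%N by nia.
by lia.
Qed.

Lemma low0 m : low m (0 : {mpoly R[N]}).
Proof. by move=> b _; rewrite mcoeff0. Qed.

Lemma lowD m f g : low m f -> low m g -> low m (f + g).
Proof. by move=> lf lg b Pb; rewrite mcoeffD lf ?lg ?addr0. Qed.

Lemma lowN m f : low m f -> low m (- f).
Proof. by move=> lf b Pb; rewrite mcoeffN lf ?oppr0. Qed.

Lemma lowZ m k f : low m f -> low m (k *: f).
Proof. by move=> lf b Pb; rewrite mcoeffZ lf ?mulr0. Qed.

Lemma low_sum m (I : Type) (r : seq I) (P : pred I) (G : I -> {mpoly R[N]}) :
  (forall x, P x -> low m (G x)) -> low m (\sum_(x <- r | P x) G x).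
Proof. by move=> lG; apply: big_ind => //; [exact: low0|exact: lowD]. Qed.

Lemma lowX m b : (Phi b < Phi m)%N -> low m ('X_[b] : {mpoly R[N]}).
Proof.
move=> lt c le; rewrite mcoeffX; case: eqP => // E.
by move: lt; rewrite E; lia.
Qed.

(** The diagonal coefficient is 1 exactly for the [j] not counted by [rank m i], so the sum over [j]
    is [N - rank m i]. *)
Lemma term_triangular m i j : j != i ->
  low m (divdiffX R m i j (m i).+1 (m j)
         - (if (j < i)%N then 'X_[mset2 m i j (m j) (m i)] else 0)
         - (~~ ((m i < m j) || (m j == m i) && (j <= i))%N)%:R *: 'X_[m]).
Proof.
move=> ji; have ij : i != j by rewrite eq_sym.
have jiv : (j <> i :> nat) by move=> E; case/eqP: ji; apply: val_inj.
rewrite /divdiffX; case: (ltngtP (m i) (m j)) => mij /=.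
- rewrite scale0r subr0 (_ : ((m i).+1 - m j = 0)%N) ?big_ord0; last by lia.
  rewrite sub0r; apply: lowD; apply: lowN.
    apply: low_sum => t _; apply/lowX/Phi_flat => //; have := ltn_ord t; lia.
  case: ifP => lt; last exact: low0.
  by rewrite mset2C //; apply/lowX/Phi_swap.
(* The first summand is [m] itself, the last is [m] with the two exponents exchanged: cancelled by
   the transposition if [j < i], lower by [Phi_swap] if [i < j]. *)
- rewrite (_ : (m j - (m i).+1 = 0)%N) ?big_ord0; last by lia.
  rewrite subr0 (_ : ((m i).+1 - m j = (m i - m j).-1.+2)%N); last by lia.
  rewrite big_ord_recl big_ord_recr /= addn0 mset2_id scale1r.
  have -> : mset2 m i j ((m i).+1 - bump 0 (m i - m j).-1).-1 (m j + bump 0 (m i - m j).-1)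
     = mset2 m i j (m j) (m i) by congr mset2; rewrite /bump /=; lia.
  rewrite addrAC [X in X - _]addrC addKr -addrA.
  apply: lowD.
    apply: low_sum => t _; apply/lowX/Phi_flat => //; have := ltn_ord t; rewrite /bump /=; lia.
  case: ifP => lt; first by rewrite subrr; exact: low0.
  by rewrite subr0; apply/lowX/Phi_swap; lia.
rewrite mij (_ : ((m j).+1 - m j = 1)%N) ?big_ord1; last by lia.
rewrite (_ : (m j - (m j).+1 = 0)%N) ?big_ord0 ?subr0; last by lia.
have E : mset2 m i j (m j) (m j) = m by rewrite -{1}mij mset2_id.
rewrite addn0 /= E.
by case: (ltngtP j i) => [lt|gt|/jiv//] /=; rewrite ?scale0r ?scale1r ?subr0 subrr; exact: low0.
Qed.

Lemma opUX_triangular k i m :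
  low m (opUX k i m - ((m i).+1%:R + k * (N - rank m i)%:R) *: 'X_[m]).
Proof.
have -> : (N - rank m i)%N = (\sum_(j < N | j != i)
    ~~ ((m i < m j) || (m j == m i) && (j <= i)))%N.
  rewrite rankE; set A := [set _ | _].
  rewrite -[X in (X - _)%N]card_ord -(cardsC A) addKn -sum1_card.
  rewrite big_mkcond [RHS]big_mkcond; apply: eq_bigr => j _; rewrite !inE.
  by case: (eqVneq j i) => [->|_]; rewrite ?eqxx ?leqnn ?orbT //; case: (~~ _).
rewrite /opUX scalerDl opprD addrACA subrr add0r -scalerA -scalerBr.
rewrite natr_sum scaler_suml -sumrB; apply/lowZ/low_sum => j ji.
exact: term_triangular.
Qed.
End Triangular.

(** * Eigenvectors and specialization *)

(** The eigenvalue [xi] with [kappa] replaced by [k]; the natural subtraction is exact by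
    [rank_le_N]. *)
Definition spectrum (R : comNzRingType) (N : nat) (k : R) (a : 'X_{1..N}) (i : 'I_N) : R :=
  (a i).+1%:R + k * (N - rank a i)%:R.

Section Eigen.
Variables (F : fieldType) (N : nat).
Implicit Types (f : {mpoly F[N]}) (k : F) (e : 'I_N -> F).

Lemma Phi_max f : f != 0 ->
  exists2 g, g \in msupp f & forall b, b \in msupp f -> (Phi b <= Phi g)%N.
Proof.
rewrite -msupp_eq0; case: (msupp f) => // a r _; elim: r a => [|b r IH] a.
  by exists a; rewrite ?mem_head // => b; rewrite inE => /eqP ->.
have [g gr gmax] := IH b.
have [ag|ga] := leqP (Phi a) (Phi g).
  exists g; first by rewrite inE gr orbT.
  by move=> c; rewrite inE => /orP[/eqP-> //|]; exact: gmax.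
exists a; first exact: mem_head.
move=> c; rewrite inE => /orP[/eqP-> //|cr].
by rewrite (leq_trans (gmax _ cr)) // ltnW.
Qed.

(** By triangularity and maximality of [g], the coefficient at [g] of the image comes from the
    monomial [g] alone, and it is nonzero in [f]. *)
Lemma eigen_spectrum k e f g :
  (forall y, opU k y f = e y *: f) ->
  g \in msupp f -> (forall b, b \in msupp f -> (Phi b <= Phi g)%N) ->
  forall y, e y = spectrum k g y.
Proof.
move=> ef gf gmax y; have := congr1 (mcoeff g) (ef y).
have gx m : m \in msupp f -> (opU k y 'X_[m])@_g = spectrum k m y * (m == g)%:R.
  move=> /gmax le; have := opUX_triangular k y le.
  by rewrite mcoeffB mcoeffZ mcoeffX opU_X => /eqP; rewrite subr_eq0 => /eqP.
rewrite opU_sum raddf_sum /= big_seq.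
under eq_bigr => m mf do rewrite mcoeffZ gx //.
rewrite -big_seq (bigD1_seq g) //= ?msupp_uniq // eqxx mulr1 big1 => [|m mg].
  rewrite addr0 mcoeffZ mulrC => H; apply/esym; apply: mulIf H.
  by rewrite -mcoeff_msupp.
by rewrite (negbTE mg) !mulr0.
Qed.
End Eigen.

(* On monomials opU is defined over every commutative ring, so an eigenvalue
   equation transfers through the ring A. *)
Lemma opU_specialize (A : comNzRingType) (K F : fieldType) (N : nat)
    (phi : {rmorphism A -> K}) (ev : {rmorphism A -> F}) (k : A) (e : 'I_N -> A)
    (Y : {mpoly A[N]}) :
  injective phi ->
  (forall i, opU (phi k) i (map_mpoly phi Y) = phi (e i) *: map_mpoly phi Y) ->
  forall i, opU (ev k) i (map_mpoly ev Y) = ev (e i) *: map_mpoly ev Y.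
Proof.
move=> phi_inj eY i.
(* [W] is the image of [Y] computed over [A], and it is compatible with every homomorphism into a
   field. *)
pose W := \sum_(m <- msupp Y) Y@_m *: opUX k i m.
have mapW (S : fieldType) (f : {rmorphism A -> S}) :
    map_mpoly f W = opU (f k) i (map_mpoly f Y).
  rewrite [Y in RHS]mpolyE /W; elim: (msupp Y) => [|m r IH].
    by rewrite !big_nil !rmorph0 -[X in opU _ _ X](scale0r 0) opUZ scale0r.
  by rewrite !big_cons !rmorphD /= opUD IH !map_mpolyZ map_mpolyX opUZ opU_X map_opUX.
have WE : W = e i *: Y.
  apply/mpolyP => b; apply: phi_inj; rewrite -!mcoeff_map_mpoly mapW eY.
  by rewrite map_mpolyZ.
by rewrite -mapW WE map_mpolyZ.
Qed.

Lemma fraction_numden (A : idomainType) (c : {fraction A}) :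
  exists n d : A, d != 0 /\ c * FracField.tofrac d = FracField.tofrac n.
Proof.
elim/quotW: c => x; exists \n_x, \d_x; split; first exact: denom_ratioP.
rewrite -[_ * _]/(FracField.mul _ _); apply/eqP.
rewrite !piE FracField.equivfE /FracField.mulf !numden_Ratio ?oner_eq0 ?mulf_neq0 ?denom_ratioP //.
by rewrite !mulr1 mulrC.
all: exact: oner_neq0.
Qed.

Lemma clear_denominators (A : idomainType) (N : nat) (z : {mpoly {fraction A}[N]}) :
  exists2 P : A, P != 0 & exists Y : {mpoly A[N]},
    map_mpoly (@FracField.tofrac A) Y = FracField.tofrac P *: z.
Proof.
elim/mpolyind: z => [|c m p _ _ [P P0 [Y YE]]].
  by exists 1; rewrite ?oner_eq0 //; exists 0; rewrite rmorph0 scaler0.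
have [n [d [d0 cd]]] := fraction_numden c.
exists (d * P); first by rewrite mulf_neq0.
exists ((n * P) *: 'X_[m] + d *: Y).
rewrite rmorphD /= !map_mpolyZ map_mpolyX YE scalerDr !scalerA !rmorphM /= -cd.
by congr (_ *: _ + _); rewrite [RHS]mulrC mulrA.
Qed.

(** * Absence of a pole at the special value *)

Section Regularity.
Variables (N : nat) (k0 : rat) (a : 'X_{1..N}) (z : {mpoly Qkappa[N]}).
Variable e : 'I_N -> {poly rat}.
Hypothesis za : z@_a = 1.
Hypothesis eigz : forall i, opU kappa i z = FracField.tofrac (e i) *: z.
Hypothesis uniq : forall g, (forall y, (e y).[k0] = spectrum k0 g y) -> g = a.

Let phi : {rmorphism {poly rat} -> Qkappa} := @FracField.tofrac {poly rat}.
Let ev : {rmorphism {poly rat} -> rat} := horner_eval k0.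

Lemma phi_inj : injective phi.
Proof. by move=> p q /eqP; rewrite tofrac_eq => /eqP. Qed.

Lemma eigen_numerator (P : {poly rat}) (Y : {mpoly {poly rat}[N]}) : map_mpoly phi Y = phi P *: z ->
  forall i, opU k0 i (map_mpoly ev Y) = (e i).[k0] *: map_mpoly ev Y.
Proof.
move=> YP i; have := opU_specialize (k := 'X) (e := e) ev phi_inj _ i.
rewrite {1}/ev /= /horner_eval hornerX; apply => j.
by rewrite YP opUZ eigz !scalerA mulrC.
Qed.

(** A nonzero specialization would have a [Phi]-maximal exponent with the spectrum of [a], hence [a]
    itself, but its coefficient there is [P.[k0] = 0]. *)
Lemma eigen_numerator_eq0 (P : {poly rat}) (Y : {mpoly {poly rat}[N]}) : P.[k0] = 0 -> map_mpoly phi Y = phi P *: z ->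
  map_mpoly ev Y = 0.
Proof.
move=> P0 YP; have YaP : Y@_a = P.
  by apply: phi_inj; rewrite -mcoeff_map_mpoly YP mcoeffZ za mulr1.
apply/eqP/negPn/negP => /Phi_max[g gY gmax].
have ga := uniq (eigen_spectrum (eigen_numerator YP) gY gmax).
by move: gY; rewrite mcoeff_msupp mcoeff_map_mpoly ga YaP /= /horner_eval P0 eqxx.
Qed.

(** As long as [P] vanishes at [k0], so does every coefficient of [Y], and the common factor
    ['X - k0] cancels; the size of [P] drops. *)
Lemma regular_numerator n (P : {poly rat}) (Y : {mpoly {poly rat}[N]}) : (size P <= n)%N -> P != 0 ->
  map_mpoly phi Y = phi P *: z ->
  exists P' Y', P'.[k0] != 0 /\ map_mpoly phi Y' = phi P' *: z.
Proof.
elim: n P Y => [|n IH] P Y sP Pn0 YP.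
  by move: sP Pn0; rewrite leqn0 size_poly_eq0 => ->.
have [P0|] := eqVneq P.[k0] 0; last by exists P, Y.
have ev0 := eigen_numerator_eq0 P0 YP.
pose d : {poly rat} := 'X - k0%:P.
have d0 : d != 0 by rewrite polyXsubC_eq0.
have divd (p : {poly rat}) : p.[k0] = 0 -> d * (p %/ d) = p.
  by move=> p0; rewrite mulrC divpK // dvdp_XsubCl; apply/rootP.
pose Y' := \sum_(b <- msupp Y) (Y@_b %/ d) *: 'X_[b].
have dY' : d *: Y' = Y.
  rewrite [RHS]mpolyE scaler_sumr; apply: eq_bigr => b _.
  rewrite scalerA divd //.
  by have := congr1 (mcoeff b) ev0; rewrite mcoeff_map_mpoly mcoeff0.
apply: (IH (P %/ d) Y').
- by rewrite size_divp // size_XsubC /= leq_subLR.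
- by apply: contraNneq Pn0 => Pd; rewrite -(divd P) // Pd mulr0.
apply: (@scalerI _ _ (phi d)); first by rewrite tofrac_eq0.
by rewrite -map_mpolyZ dY' YP scalerA -rmorphM divd.
Qed.

Lemma jack_regular : exists p : {mpoly rat[N]},
  [/\ specializes k0 z p, p@_a = 1 & forall i, opU k0 i p = (e i).[k0] *: p].
Proof.
have [P0 P0n [Y0 YP0]] := clear_denominators z.
have [P [Y [Pk YP]]] := regular_numerator (leqnn _) P0n YP0.
have Pn : phi P != 0.
  by rewrite tofrac_eq0; apply: contraNneq Pk => ->; rewrite horner0.
exists (P.[k0]^-1 *: map_mpoly ev Y); split.
- move=> b; exists Y@_b, P; split=> //; last by rewrite mcoeffZ mcoeff_map_mpoly mulrC.
  have := congr1 (mcoeff b) YP; rewrite mcoeff_map_mpoly mcoeffZ => E.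
  by apply: (mulIf Pn); rewrite divfK // mulrC -E.
- rewrite mcoeffZ mcoeff_map_mpoly /=.
  have -> : Y@_a = P.
    by apply: phi_inj; rewrite -mcoeff_map_mpoly YP mcoeffZ za mulr1.
  by rewrite /horner_eval mulVf.
by move=> i; rewrite opUZ (eigen_numerator YP) !scalerA mulrC.
Qed.
End Regularity.

(** * Singularity *)

Section LastVariable.
Variables (F : fieldType) (N : nat).

Lemma divdiff_XM (i j : 'I_N) (f : {mpoly F[N]}) : i != j ->
  divdiff i j ('X_i * f) = 'X_i * divdiff i j f + swap i j f.
Proof.
move=> ij; apply: divdiff_uniq => //.
by rewrite mulrDr mulrCA divdiffP swap_XM tpermL; ring.
Qed.

(** For the last index every [j != i] satisfies [j < i], so the transpositions produced by
    [divdiff_XM] cancel those subtracted in [opU]. *)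
Lemma opU_last (k : F) (i : 'I_N) (f : {mpoly F[N]}) : i.+1 = N ->
  opU k i f = f + 'X_i * dunkl k i f.
Proof.
move=> iN; rewrite /opU /dunkl mderivM mderivX mnm1E eqxx scale1r.
have -> : (U_(i) - U_(i))%MM = 0%MM :> 'X_{1..N}.
  by apply/mnmP => t; rewrite mnmBE mnm0E subnn.
rewrite mpolyX0 mul1r mulrDr -scalerAr mulr_sumr -!addrA; congr (_ + (_ + _)).
rewrite -scalerBr; congr (_ *: _); apply/eqP; rewrite subr_eq; apply/eqP.
transitivity (\sum_(j < N | j != i) ('X_i * divdiff i j f + swap i j f)).
  by apply: eq_bigr => j ji; rewrite divdiff_XM // eq_sym.
rewrite big_split mulr_sumr /=; congr (_ + _); apply: eq_big => j.
  by rewrite -val_eqE /=; have := ltn_ord j; lia.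
by move=> _; rewrite swapC.
Qed.
End LastVariable.

Section Singular.
Variables mu s m N : nat.
Hypothesis mu_gt0 : (0 < mu)%N.
Hypothesis m_gt0 : (0 < m)%N.
Hypothesis mn_coprime : coprime m mu.+1.

Let k0 : rat := - (m%:R / mu.+1%:R).
Let h := height mu s.
(** Position [y] carries box [N - y.+1]; [pad_LambdaE] identifies this composition with [Lambda]. *)
Definition lambda : 'X_{1..N} := [multinom (m * h (N - y.+1))%N | y < N].
Let e := spectrum k0 lambda.

Lemma height_mono j k : (j <= k)%N -> (h j <= h k)%N.
Proof.
move=> jk; rewrite /h /height; case: ltnP => // Zj; rewrite ifF; last by apply/negbTE; lia.
by rewrite leq_add2l leq_div2r // leq_sub2r.
Qed.

Lemma rank_lambda (y : 'I_N) : rank lambda y = y.+1.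
Proof.
apply: rank_nonincreasing => i j ij; rewrite !mnmE leq_mul2l height_mono ?orbT //.
by lia.
Qed.

Lemma spectrum_lambda (y : 'I_N) : e y = (m * h (N - y.+1))%:R + 1 + k0 * (N - y.+1)%:R.
Proof. by rewrite /e /spectrum rank_lambda mnmE -addn1 natrD. Qed.

(** [spectrum_rigid] in terms of positions: [pi y] is the label whose spectral value stands at [y],
    and [i] is the only label moved to the right past larger ones. *)
Lemma spectrum_rigid_perm (pi : 'S_N) (g : 'X_{1..N}) (i : 'I_N) :
  (forall y, e (pi y) = spectrum k0 g y) ->
  (forall x y : 'I_N, (x < y)%N -> (pi^-1%g y < pi^-1%g x)%N -> x = i) ->
  (forall x y : 'I_N, (x < y)%N -> (pi^-1%g y < pi^-1%g x)%N ->
     (N - x.+1 + mu.+1 * h (N - y.+1) + 1 = N - y.+1 + mu.+1 * h (N - x.+1))%N ->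
     exists r, (N - y.+1 = row_start mu s r)%N /\ (N - x.+1 = row_start mu s r.+1)%N) ->
  forall y, g y = lambda (pi y) /\ rank g y = (pi y).+1.
Proof.
move=> spec uniq excl y.
pose pos (k : 'I_N) := (pi^-1)%g (rev_ord k).
have pos_inj : injective pos by move=> j k /perm_inj/rev_ord_inj.
have [|||] := @spectrum_rigid mu s m N g pos mu_gt0 m_gt0 mn_coprime pos_inj _ _ _
  (rev_ord (pi y)).
- move=> k; have := spec (pos k); rewrite spectrum_lambda permKV /spectrum /=.
  have -> : (N - (N - k.+1).+1 = k)%N by have := ltn_ord k; lia.
  by rewrite -addn1 natrD -/k0 -/h; lra.
- move=> j k j' k' kj kj' pj pj'; apply: rev_ord_inj.
  have rev_lt (x x' : 'I_N) : (x < x')%N -> (rev_ord x' < rev_ord x)%N.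
    by move=> xx /=; have := ltn_ord x'; lia.
  by rewrite (uniq _ _ (rev_lt _ _ kj) pj) (uniq _ _ (rev_lt _ _ kj') pj').
- move=> j k kj pj E; have := excl (rev_ord j) (rev_ord k) _ pj.
  rewrite /= !subnSK // !subKn ?(ltnW (ltn_ord _)) //; apply; last exact: E.
  by have := ltn_ord j; lia.
rewrite /pos rev_ordK permK => -> ->; rewrite mnmE /=; split=> //.
by have := ltn_ord (pi y); lia.
Qed.

Lemma jack_unique g : (forall y, e y = spectrum k0 g y) -> g = lambda.
Proof.
move=> spec; apply/mnmP => y.
have [|||] := @spectrum_rigid_perm 1%g g y _ _ _ y; last by rewrite perm1.
- by move=> x; rewrite perm1.
- by move=> x x'; rewrite invg1 !perm1; lia.
- by move=> x x'; rewrite invg1 !perm1; lia.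
Qed.

Variable p : {mpoly rat[N]}.
Hypothesis eigp : forall y, opU k0 y p = e y *: p.

Lemma dunkl_last (i : 'I_N) : i.+1 = N -> dunkl k0 i p = 0.
Proof.
move=> iN; have := eigp i; rewrite opU_last // spectrum_lambda iN subnn mulr0.
(* Box 0 has height and content 0, so the eigenvalue is 1 and [opU_last] leaves [x_i] times the
   Dunkl image equal to 0. *)
have -> : h 0 = 0%N by rewrite /h /height; case: ifP => //; nia.
rewrite muln0 !addr0 add0r scale1r -[RHS]addr0 => /addrI/eqP.
rewrite mulf_eq0 => /orP[/eqP/(congr1 (mcoeff U_(i)))|/eqP//].
by rewrite mcoeffXU eqxx mcoeff0 => /eqP; rewrite oner_eq0.
Qed.

(** Neighbours in a row have spectral values differing by [k0], so [c = 1]. If the difference were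
    nonzero, rigidity would give a leading exponent equal at [a] and [b] with exchanged ranks, but
    ties are ranked from left to right. *)
Lemma swap_same_row (a b : 'I_N) : b = a.+1 :> nat ->
  h (N - a.+1) = h (N - b.+1) -> swap a b p = p.
Proof.
move=> ab hab.
have aN := ltn_ord b.
have w_eig : forall y, opU k0 y (swap a b p - 1 *: p) = e (tperm a b y) *: (swap a b p - 1 *: p).
  apply: opU_intertwine => //; rewrite mul1r !spectrum_lambda hab.
  have -> : (N - a.+1 = (N - b.+1) + 1)%N by lia.
  by rewrite natrD; ring.
rewrite scale1r in w_eig.
apply/eqP; rewrite -subr_eq0; apply/negPn/negP => /Phi_max[g gw gmax].
have spec := eigen_spectrum w_eig gw gmax.
have inv (x y : 'I_N) : (x < y)%N -> ((tperm a b)^-1%g y < (tperm a b)^-1%g x)%N -> x = a /\ y = b.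
  rewrite tpermV; case: tpermP => [->|->|]; case: tpermP => [->|->|]; rewrite ?ab //; lia.
have [||ga ra] := @spectrum_rigid_perm (tperm a b) g a spec _ _ a.
- by move=> x y xy /(inv _ _ xy)[].
- by move=> x y xy /(inv _ _ xy)[-> ->]; rewrite hab; lia.
have [||gb rb] := @spectrum_rigid_perm (tperm a b) g a spec _ _ b.
- by move=> x y xy /(inv _ _ xy)[].
- by move=> x y xy /(inv _ _ xy)[-> ->]; rewrite hab; lia.
move: ga ra gb rb; rewrite tpermL tpermR !mnmE => ga ra gb rb.
have [|lt|[_ lt]] := @ltn_rank _ g b a.
- by rewrite ra rb ab.
- by move: lt; rewrite ga gb hab ltnn.
- by move: lt; rewrite ab; lia.
Qed.

(** * Moving the first box of a row past the preceding row *)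

Section RowEnd.
Variables (r : nat) (i : 'I_N).
Hypothesis i_row : (N - i.+1 = row_start mu s r.+1)%N.
Hypothesis dunkl_gt : forall y : 'I_N, (i < y)%N -> dunkl k0 y p = 0.

Let L := (row_start mu s r.+1 - row_start mu s r)%N.

Lemma row_length : [/\ (0 < L)%N, row_start mu s r.+1 = (row_start mu s r + L)%N & (i + L < N)%N].
Proof.
have := ltn_ord i; move: i_row; rewrite /L; case: (r) => [|r'] /=; last by split; nia.
by split; nia.
Qed.

Lemma height_row_end : h (N - i.+1) = (s + 1 + r)%N.
Proof.
rewrite i_row /h (height_row (r := r.+1)) //=.
by case: (r) => [|r'] /=; nia.
Qed.

(** Row 0 has [(s + 1) * mu.+1 - 1] boxes and lies [s + 1] below row 1; later rows have [mu] boxes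
    and steps of one. Either way [L.+1] is [mu.+1] times the step. *)
Lemma height_gap (b : nat) : (i < b <= i + L)%N ->
  (mu.+1 * h (N - i.+1) = mu.+1 * h (N - b.+1) + L.+1)%N.
Proof.
have [L0 rL iL] := row_length; move=> ib.
rewrite height_row_end /h (height_row (r := r)) //; last by lia.
by rewrite /L; case: (r) => [|r'] /=; nia.
Qed.

(** The intertwining constant at [b] is therefore [-1 / (L.+1 - (b - i))]: it is defined all along
    the row and equals -1 at [b = i + L]. *)
Lemma eigen_gap (b : 'I_N) : (i < b <= i + L)%N ->
  e i - e b = m%:R / mu.+1%:R * (L.+1 - (b - i))%:R.
Proof.
move=> ib; have n0 : mu.+1%:R != 0 :> rat by rewrite pnatr_eq0.
have [L0 rL iL] := row_length.
have := congr1 (fun x => x%:R : rat) (height_gap ib).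
rewrite !spectrum_lambda; have -> : (N - i.+1 = (N - b.+1) + (b - i))%N by have := ltn_ord b; lia.
rewrite [(L.+1 - _)%:R]natrB; last by lia.
set h1 := h (_ + _)%N; set h2 := h _.
rewrite 2!natrD !natrM /k0.
have xn : m%:R = m%:R / mu.+1%:R * mu.+1%:R :> rat by rewrite divfK.
set x := m%:R / mu.+1%:R in xn *; rewrite xn => /(congr1 ( *%R x)); lra.
Qed.

(* The label at position y after the label i was moved right past j labels. *)
Definition cyc (j y : nat) : nat :=
  if y == (i + j)%N then nat_of_ord i else if (i <= y < i + j)%N then y.+1 else y.

(** Since the Dunkl operator at [b] kills [v], on [swap a b v - c *: v] it gives just the exchange
    of the image of [v] at [a]; vanishing thus propagates back to [i]. The last box of the passage,
    at [i + L], is left out because there [c = -1]. *)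
Lemma intertwined_vector j : (j < L)%N -> exists v (pi : 'S_N),
  [/\ forall y, pi y = cyc j y :> nat,
      forall y, opU k0 y v = e (pi y) *: v,
      forall y : 'I_N, (i + j < y)%N -> dunkl k0 y v = 0
    & forall a : 'I_N, a = (i + j)%N :> nat -> dunkl k0 a v = 0 -> dunkl k0 i p = 0].
Proof.
have [L0 rL iL] := row_length.
elim: j => [_|j IH jL].
  exists p, 1%g; split=> [y|y|y|a].
  - by rewrite perm1 /cyc addn0; case: eqP => [->//|]; case: ifP => //; lia.
  - by rewrite perm1.
  - by rewrite addn0; exact: dunkl_gt.
  - by rewrite addn0 => /val_inj ->.
have [v [pi [piE eigv dv dp]]] := IH ltac:(lia).
have aN : (i + j < N)%N by lia.
have bN : (i + j.+1 < N)%N by lia.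
pose a := Ordinal aN; pose b := Ordinal bN.
have ab : b = a.+1 :> nat by rewrite /= addnS.
have pa : pi a = i by apply: val_inj; rewrite /= piE /cyc eqxx.
have pb : pi b = b.
  by apply: val_inj; rewrite /= piE /cyc /=; case: eqP; [lia|]; case: ifP; lia.
pose c := k0 / (e (pi a) - e (pi b)).
exists (swap a b v - c *: v), (tperm a b * pi)%g; split=> [y|y|y|b'].
- rewrite permM; case: tpermP => [->|->|].
  + by rewrite pb /cyc /=; case: eqP; [lia|]; case: ifP; lia.
  + by rewrite pa /cyc /= eqxx.
  move=> /eqP; rewrite -val_eqE /= => ya /eqP; rewrite -val_eqE /= => yb.
  by rewrite piE /cyc; do 2 (case: eqP; [lia|]); move=> _ _; do 2 case: ifP; lia.
- rewrite permM (opU_intertwine (e := fun y => e (pi y))) //.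
  rewrite divfK // pa pb eigen_gap /=; last by lia.
  by rewrite mulf_neq0 // ?mulf_neq0 ?invr_eq0 ?pnatr_eq0; lia.
- move=> y_gt; rewrite -scaleNr dunklD dunklZ dv; last by lia.
  have := swap_dunkl a b k0 y v; rewrite tpermD -?val_eqE /=; [|lia|lia].
  by rewrite dv /swap ?msym0; [move=> <-; rewrite scaler0 addr0|lia].
move=> b'E; have {b' b'E} -> : b' = b by apply: val_inj.
rewrite -scaleNr dunklD dunklZ (dv b) ?scaler0 ?addr0; last by rewrite /=; lia.
have := swap_dunkl a b k0 a v; rewrite tpermL => <- /(congr1 (swap a b)).
by rewrite swapK /swap msym0; exact: dp.
Qed.

Lemma dunkl_row_end : dunkl k0 i p = 0.
Proof.
have [L0 rL iL] := row_length.
have [v [pi [piE eigv dv dp]]] := intertwined_vector (j := L.-1) ltac:(lia).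
have aN : (i + L.-1 < N)%N by lia.
pose a := Ordinal aN; pose b := Ordinal iL.
have ab : b = a.+1 :> nat by rewrite /=; lia.
have pa : pi a = i by apply: val_inj; rewrite /= piE /cyc eqxx.
have pb : pi b = b.
  by apply: val_inj; rewrite /= piE /cyc /=; case: eqP; [lia|]; case: ifP; lia.
(* Once [swap a b v = - v], the operator at [b] gives 0 on both sides, and the exchange carries this
   to [a]. *)
suff w0 : swap a b v + v = 0.
  apply: (dp a) => //; have := congr1 (dunkl k0 b) w0.
  rewrite dunklD (dv b) ?addr0; last by rewrite /=; lia.
  have := swap_dunkl a b k0 a v; rewrite tpermL => <- /(congr1 (swap a b)).
  by rewrite swapK dunkl0 /swap msym0.
have eig_w : forall y, opU k0 y (swap a b v + v) = e ((tperm a b * pi)%g y) *: (swap a b v + v).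
  move=> y; have := opU_intertwine (e := fun y => e (pi y)) (c := -1) ab eigv _ y.
  rewrite scaleN1r opprK permM; apply.
  rewrite pa pb eigen_gap /=; last by lia.
  by rewrite (_ : (L.+1 - (i + L - i) = 1)%N) ?mulr1 ?mulN1r //; lia.
apply/eqP/negPn/negP => /Phi_max[g gw gmax].
have spec := eigen_spectrum eig_w gw gmax.
have piL y : (tperm a b * pi)%g y = cyc L y :> nat.
  rewrite permM; case: tpermP => [->|->|].
  + by rewrite pb /cyc /=; case: eqP; [lia|]; case: ifP; lia.
  + by rewrite pa /cyc /= eqxx.
  move=> /eqP; rewrite -val_eqE /= => ya /eqP; rewrite -val_eqE /= => yb.
  by rewrite piE /cyc; do 2 (case: eqP; [lia|]); move=> _ _; do 2 case: ifP; lia.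
set sg := (tperm a b * pi)%g in spec piL.
have inv (x y : 'I_N) : (x < y)%N -> (sg^-1%g y < sg^-1%g x)%N -> x = i /\ (i < y <= i + L)%N.
  have := piL (sg^-1%g x); have := piL (sg^-1%g y); rewrite !permKV.
  move: (sg^-1%g x : nat) (sg^-1%g y : nat) => x' y'.
  rewrite /cyc => yE xE xy yx'.
  suff [xi iy] : x = i :> nat /\ (i < y <= i + L)%N by split=> //; apply: val_inj.
  move: yE xE; case: eqP => y'L; case: eqP => x'L; try case: ifP; try case: ifP; lia.
have gE := spectrum_rigid_perm spec (fun x y xy yx => (inv x y xy yx).1) _.
have {}gE y : g y = lambda (sg y).
  (* By [height_gap], consecutive contents force [x' = i + L], the first box of the preceding
     row. *)
  apply: (gE _ y).1 => x x' xx' /(inv _ _ xx')[-> ix'].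
  by rewrite (height_gap ix') => E; exists r; split=> //; lia.
have lt : (g a < g b)%N.
  rewrite !gE !mnmE !piL /cyc /= eqxx.
  have := @height_gap (i + L) ltac:(lia).
  case: eqP => [|_]; first by lia.
  rewrite ifT; last by lia.
  by rewrite (_ : (i + L.-1).+1 = (i + L)%N); [rewrite ltn_pmul2l //; nia|lia].
(* By symmetry of [swap a b v + v] the exchanged exponent [g'] also occurs; its larger part stands
   further left, so [Phi g < Phi g'] contradicts maximality. *)
pose g' := mset2 g a b (g b) (g a).
have ab' : a != b by rewrite -val_eqE /=; lia.
have g'w : g' \in msupp (swap a b v + v).
  rewrite mcoeff_msupp -(_ : swap a b (swap a b v + v) = swap a b v + v); last first.
    by rewrite swapD swapK addrC.
  rewrite /swap mcoeff_sym (_ : [multinom g' (tperm a b t) | t < N] = g) -?mcoeff_msupp //.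
  apply/mnmP => t; rewrite !mnmE; case: tpermP => [->|->|/eqP ta /eqP tb].
  - by rewrite eq_sym (negbTE ab') eqxx.
  - by rewrite eqxx.
  by rewrite (negbTE ta) (negbTE tb).
have := gmax _ g'w; rewrite leqNgt => /negP; apply.
have g'a : g' a = g b by rewrite mnmE eqxx.
have g'b : g' b = g a by rewrite mnmE eq_sym (negbTE ab') eqxx.
have := @Phi_swap _ g' a b; rewrite g'a g'b.
rewrite (_ : mset2 g' a b (g a) (g b) = g); first by apply=> //=; lia.
by apply/mnmP => t; rewrite !mnmE; case: eqVneq => [->//|_]; case: eqVneq => [->|].
Qed.
End RowEnd.
End Singular.

(** * Descent over all positions and identification of the exponent *)

Lemma height_step mu s k : (0 < mu)%N ->
  height mu s k.+1 = height mu s k \/ exists r, k.+1 = row_start mu s r.+1.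
Proof.
move=> mu0; rewrite /height; set Z := ((s + 1) * mu + s)%N.
have [lt|le] := ltnP k.+1 Z; first by left; rewrite ltnW.
have [E|ne] := eqVneq k.+1 Z.
  by right; exists 0%N; rewrite /= mul0n addn0.
have Zk : (Z <= k)%N by lia.
rewrite ltnNge Zk /= subSn // divnS //; case: (boolP (mu %| (k - Z).+1)%N) => [/dvdnP[q Eq]|_].
  by right; exists q; rewrite /= -/Z -Eq; lia.
by left.
Qed.

Lemma dunkl_eq0 mu s m N (p : {mpoly rat[N]}) (k0 := - (m%:R / mu.+1%:R) : rat) :
  (0 < mu)%N -> (0 < m)%N -> coprime m mu.+1 ->
  (forall y, opU k0 y p = spectrum k0 (lambda mu s m N) y *: p) ->
  forall y, dunkl k0 y p = 0.
Proof.
move=> mu0 m0 mn eigp y; have [d] := ubnP (N - y)%N.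
elim: d y => [|d IH] y; first by lia.
rewrite ltnS => yd.
have dgt (x : 'I_N) : (y < x)%N -> dunkl k0 x p = 0.
  by move=> yx; apply: IH; have := ltn_ord x; lia.
have yN := ltn_ord y.
have [yl|ne] := eqVneq y.+1 N; first exact: (dunkl_last mu0 m0 mn eigp yl).
have bN : (y.+1 < N)%N by lia.
pose b := Ordinal bN.
have E : (N - y.+1 = (N - b.+1).+1)%N by rewrite /=; lia.
case: (height_step s (N - b.+1) mu0) => [hE|[r rE]].
  have sp := swap_same_row mu0 m0 mn eigp (a := y) (b := b) erefl.
  rewrite E in sp; have {}sp := sp hE.
  have := swap_dunkl y b k0 b p; rewrite tpermR sp dgt //.
  by rewrite /swap msym0.
by apply: (dunkl_row_end mu0 m0 mn eigp (r := r)) => //; rewrite E.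
Qed.

Lemma nth_flatten_nseq (mu : nat) (f : nat -> nat) l x y : (0 < mu)%N ->
  nth 0%N (flatten [seq nseq mu (f t) | t <- iota x l]) y
    = if (y < l * mu)%N then f (x + y %/ mu)%N else 0%N.
Proof.
move=> mu0; elim: l x y => [|l IH] x y; first by rewrite nth_nil.
rewrite /= nth_cat size_nseq mulSn; case: ltnP => [ymu|muy].
  by rewrite nth_nseq ymu divn_small // addn0 ifT //; lia.
rewrite IH -ltn_subLR //; case: ifP => // _; congr f.
by rewrite -{2}(subnK muy) divnDr ?dvdnn // divnn mu0; lia.
Qed.

Lemma pad_LambdaE mu l m s rho N : (0 < mu)%N -> (rho <= mu)%N ->
  N = ((s + l + 1) * mu + s + rho)%N ->
  pad N (Lambda mu s l rho m) = lambda mu s m N.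
Proof.
move=> mu0 rhomu NE; apply/mnmP => y; rewrite !mnmE /Lambda nth_cat size_nseq.
have yN := ltn_ord y; rewrite /height; set Z := ((s + 1) * mu + s)%N.
have NZ : N = (Z + l * mu + rho)%N by rewrite /Z; lia.
case: ltnP => [yr|ry].
  rewrite nth_nseq yr ifF; last by lia.
  (* The first [rho] positions hold the last row, and [rho <= mu] keeps the quotient at [l]. *)
  congr (m * _)%N; rewrite (_ : (_ %/ mu = l)%N); first by lia.
  by apply/eqP; rewrite eqn_leq leq_divRL // -ltnS ltn_divLR //; lia.
rewrite nth_flatten_nseq // add0n; case: ltnP => [yl|ly]; last by rewrite ifT ?muln0 //; lia.
rewrite ifF; last by lia.
have D := divn_eq (y - rho) mu; have B := ltn_pmod (y - rho) mu0.
have ql : ((y - rho) %/ mu < l)%N by rewrite ltn_divLR.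
congr (m * _)%N; rewrite (_ : (N - y.+1 - Z) %/ mu = l - ((y - rho) %/ mu).+1)%N; first by lia.
move: D B ql; move: (_ %/ mu)%N (_ %% mu)%N => a b D B al.
by apply/eqP; rewrite eqn_leq leq_divRL // -ltnS ltn_divLR // mulSn mulnBl mulSn; nia.
Qed.

Theorem theorem5 (mu l m s rho N : nat) (z : {mpoly Qkappa[N]})
    (hmu : (1 <= mu)%N) (hl : (1 <= l)%N) (hm : (1 <= m)%N)
    (hrho : (1 <= rho <= mu)%N) (hgcd : coprime m mu.+1)
    (hN : N = ((s + l + 1) * mu + s + rho)%N)
    (hz : is_jack (pad N (Lambda mu s l rho m)) z) :
  exists p : {mpoly rat[N]},
    specializes (- (m%:R / mu.+1%:R)) z p
    /\ singular_poly (- (m%:R / mu.+1%:R)) p.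
Proof.
move: hz; rewrite (pad_LambdaE m hmu _ hN); last by case/andP: hrho.
set a := lambda mu s m N; set k0 := - _ => -[za _ eigz].
(* The eigenvalues are polynomials in [kappa], so they can be evaluated at [k0]. *)
pose e i : {poly rat} := (a i).+1%:R + 'X * (N - rank a i)%:R.
have eE i : (e i).[k0] = spectrum k0 a i.
  by rewrite /e /spectrum hornerD hornerM hornerX -!polyC_natr !hornerC.
have eigz' i : opU kappa i z = FracField.tofrac (e i) *: z.
  rewrite eigz /xi /e; congr (_ *: _).
  rewrite tofracD tofracM !rmorph_nat -/kappa natrB ?rank_le_N //.
  by rewrite -addrA -natr1 addrC mulrC.
have [|p [zp pa eigp]] := jack_regular (k0 := k0) za eigz'.
  by move=> g ge; apply: (jack_unique hmu hm hgcd) => y; rewrite -eE; exact: ge.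
exists p; split=> //; split.
  by apply: contra_eq_neq pa => ->; rewrite mcoeff0 eq_sym oner_eq0.
by apply: (dunkl_eq0 hmu hm hgcd) => y; rewrite eigp eE.
Qed.
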